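(* For all incidence hypergraphs $G,H$ there are isomorphisms $\left(G\blacksquare H\right)^{\#}\cong G^{\#}\blacksquare H\cong G\blacksquare H^{\#}$ of incidence hypergraphs, natural in $G$ and $H$.
   Context: An incidence hypergraph $G$ consists of sets $\check V(G)$, $\check E(G)$, $I(G)$ and functions $\varsigma_G:I(G)\to\check V(G)$, $\omega_G:I(G)\to\check E(G)$; a homomorphism $\phi:G\to H$ is a triple of functions $\check V(\phi),\check E(\phi),I(\phi)$ with $\varsigma_H\circ I(\phi)=\check V(\phi)\circ\varsigma_G$, $\omega_H\circ I(\phi)=\check E(\phi)\circ\omega_G$. The incidence dual is $G^\#:=(\check E(G),\check V(G),I(G),\omega_G,\varsigma_G)$ (vertices and edges swapped, $\varsigma$ and $\omega$ swapped), $\phi^\#=(\check E(\phi),\check V(\phi),I(\phi))$. Laplacian product: $\check V(G\blacksquare H)=(\{1\}\times\check V(G)\times\check V(H))\cup(\{4\}\times\check E(G)\times\check E(H))$, $\check E(G\blacksquare H)=(\{2\}\times\check E(G)\times\check V(H))\cup(\{3\}\times\check V(G)\times\check E(H))$, $I(G\blacksquare H)=(\{1\}\times I(G)\times\check V(H))\cup(\{2\}\times I(G)\times\check E(H))\cup(\{3\}\times\check E(G)\times I(H))\cup(\{4\}\times\check V(G)\times I(H))$, with $\varsigma(1,x,y)=(1,\varsigma_G(x),y)$, $\varsigma(2,x,y)=(4,\omega_G(x),y)$, $\varsigma(3,x,y)=(4,x,\omega_H(y))$, $\varsigma(4,x,y)=(1,x,\varsigma_H(y))$, $\omega(1,x,y)=(2,\omega_G(x),y)$,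 $\omega(2,x,y)=(3,\varsigma_G(x),y)$, $\omega(3,x,y)=(2,x,\varsigma_H(y))$, $\omega(4,x,y)=(3,x,\omega_H(y))$. On morphisms $\phi\blacksquare\psi$ acts componentwise: vertices $(1,x,y)\mapsto(1,\check V\phi(x),\check V\psi(y))$, $(4,x,y)\mapsto(4,\check E\phi(x),\check E\psi(y))$; edges $(2,x,y)\mapsto(2,\check E\phi(x),\check V\psi(y))$, $(3,x,y)\mapsto(3,\check V\phi(x),\check E\psi(y))$; incidences $(1,x,y)\mapsto(1,I\phi(x),\check V\psi(y))$, $(2,x,y)\mapsto(2,I\phi(x),\check E\psi(y))$, $(3,x,y)\mapsto(3,\check E\phi(x),I\psi(y))$, $(4,x,y)\mapsto(4,\check V\phi(x),I\psi(y))$. *)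

(* Defs.v *)
From mathcomp Require Import ssreflect ssrfun.

Set Implicit Arguments.
Unset Strict Implicit.
Unset Printing Implicit Defensive.

Record ihgraph : Type := IHGraph {
  vertex : Type;
  edge : Type;
  incidence : Type;
  vert_of : incidence -> vertex;   (* varsigma *)
  edge_of : incidence -> edge      (* omega *)
}.

Record ihom (G H : ihgraph) : Type := IHom {
  homV : vertex G -> vertex H;
  homE : edge G -> edge H;
  homI : incidence G -> incidence H;
  homI_vert : forall i, vert_of (homI i) = homV (vert_of i);
  homI_edge : forall i, edge_of (homI i) = homE (edge_of i)
}.

Definition ihom_id (G : ihgraph) : ihom G G :=
  @IHom G G id id id (fun _ => erefl) (fun _ => erefl).

Section Composition.
Variables (G H K : ihgraph) (psi : ihom H K) (phi : ihom G H).

Fact ihom_comp_vert i :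
  vert_of (homI psi (homI phi i)) = homV psi (homV phi (vert_of i)).
Proof. by rewrite !homI_vert. Qed.

Fact ihom_comp_edge i :
  edge_of (homI psi (homI phi i)) = homE psi (homE phi (edge_of i)).
Proof. by rewrite !homI_edge. Qed.

Definition ihom_comp : ihom G K :=
  @IHom G K (homV psi \o homV phi) (homE psi \o homE phi)
    (homI psi \o homI phi) ihom_comp_vert ihom_comp_edge.

End Composition.

Definition is_iso (G H : ihgraph) (phi : ihom G H) : Prop :=
  exists psi : ihom H G,
    ihom_comp psi phi = ihom_id G /\ ihom_comp phi psi = ihom_id H.

Definition dual (G : ihgraph) : ihgraph :=
  @IHGraph (edge G) (vertex G) (incidence G) (@edge_of G) (@vert_of G).

Definition dual_hom (G H : ihgraph) (phi : ihom G H) :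
    ihom (dual G) (dual H) :=
  @IHom (dual G) (dual H) (homE phi) (homV phi) (homI phi)
    (homI_edge phi) (homI_vert phi).

(* The constructor numbers are the tags of the disjoint unions: 1 and 4 tag
   vertices, 2 and 3 tag edges, and 1 to 4 tag incidences. *)
Inductive lap_vertex (G H : ihgraph) : Type :=
| LV1 of vertex G & vertex H
| LV4 of edge G & edge H.

Inductive lap_edge (G H : ihgraph) : Type :=
| LE2 of edge G & vertex H
| LE3 of vertex G & edge H.

Inductive lap_incidence (G H : ihgraph) : Type :=
| LI1 of incidence G & vertex H
| LI2 of incidence G & edge H
| LI3 of edge G & incidence H
| LI4 of vertex G & incidence H.

Definition lap_vert_of (G H : ihgraph) (i : lap_incidence G H) :
    lap_vertex G H :=
  match i with
  | LI1 x y => LV1 (vert_of x) y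
  | LI2 x y => LV4 (edge_of x) y
  | LI3 x y => LV4 x (edge_of y)
  | LI4 x y => LV1 x (vert_of y)
  end.

Definition lap_edge_of (G H : ihgraph) (i : lap_incidence G H) :
    lap_edge G H :=
  match i with
  | LI1 x y => LE2 (edge_of x) y
  | LI2 x y => LE3 (vert_of x) y
  | LI3 x y => LE2 x (vert_of y)
  | LI4 x y => LE3 x (edge_of y)
  end.

Definition laplacian (G H : ihgraph) : ihgraph :=
  @IHGraph (lap_vertex G H) (lap_edge G H) (lap_incidence G H)
    (@lap_vert_of G H) (@lap_edge_of G H).

Section LaplacianHom.
Variables (G G' H H' : ihgraph) (phi : ihom G G') (psi : ihom H H').

Definition lap_homV (v : lap_vertex G H) : lap_vertex G' H' :=
  match v with
  | LV1 x y => LV1 (homV phi x) (homV psi y)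
  | LV4 x y => LV4 (homE phi x) (homE psi y)
  end.

Definition lap_homE (e : lap_edge G H) : lap_edge G' H' :=
  match e with
  | LE2 x y => LE2 (homE phi x) (homV psi y)
  | LE3 x y => LE3 (homV phi x) (homE psi y)
  end.

Definition lap_homI (i : lap_incidence G H) : lap_incidence G' H' :=
  match i with
  | LI1 x y => LI1 (homI phi x) (homV psi y)
  | LI2 x y => LI2 (homI phi x) (homE psi y)
  | LI3 x y => LI3 (homE phi x) (homI psi y)
  | LI4 x y => LI4 (homV phi x) (homI psi y)
  end.

Fact lap_hom_vert i : lap_vert_of (lap_homI i) = lap_homV (lap_vert_of i).
Proof. by case: i => x y /=; rewrite ?homI_vert ?homI_edge. Qed.

Fact lap_hom_edge i : lap_edge_of (lap_homI i) = lap_homE (lap_edge_of i).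
Proof. by case: i => x y /=; rewrite ?homI_vert ?homI_edge. Qed.

Definition laplacian_hom : ihom (laplacian G H) (laplacian G' H') :=
  @IHom (laplacian G H) (laplacian G' H') lap_homV lap_homE lap_homI
    lap_hom_vert lap_hom_edge.

End LaplacianHom.

Notation "G ^#" := (dual G) (at level 2, format "G ^#").
Notation "G ■ H" := (laplacian G H) (at level 40, left associativity).

(* F1, F2 are the object parts and M1, M2 the morphism parts of two functors
   of two variables on incidence hypergraphs. *)
Definition natural_iso2 (F1 F2 : ihgraph -> ihgraph -> ihgraph)
    (M1 : forall G G' H H', ihom G G' -> ihom H H' -> ihom (F1 G H) (F1 G' H'))
    (M2 : forall G G' H H', ihom G G' -> ihom H H' -> ihom (F2 G H) (F2 G' H'))
    (alpha : forall G H, ihom (F1 G H) (F2 G H)) : Prop :=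
  (forall G H, is_iso (alpha G H)) /\
  (forall G G' H H' (phi : ihom G G') (psi : ihom H H'),
     ihom_comp (alpha G' H') (M1 G G' H H' phi psi) =
     ihom_comp (M2 G G' H H' phi psi) (alpha G H)).

(* Main.v *)
(** Dualizing [G ■ H] swaps its vertices, tagged 1 and 4, with its edges, tagged
    2 and 3, and both isomorphisms only relabel the tags.  The relabelling of the
    incidences is forced by that of the vertices and edges: it is (3 4) for
    (G ■ H)^# -> G^# ■ H and (1 2)(3 4) for G^# ■ H -> G ■ H^#. *)
Require Import Defs.
From mathcomp Require Import ssreflect ssrfun.
From Stdlib Require Import FunctionalExtensionality ProofIrrelevance.

Set Implicit Arguments.
Unset Strict Implicit.
Unset Printing Implicit Defensive.

(** The two compatibility fields are proofs of equations, so once the three functions agree, proof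
    irrelevance identifies them. *)
Lemma ihom_ext (G H : ihgraph) (phi psi : ihom G H) :
  homV phi =1 homV psi -> homE phi =1 homE psi -> homI phi =1 homI psi ->
  phi = psi.
Proof.
case: phi psi => [fV fE fI pV pE] [gV gE gI qV qE] /=.
move=> /functional_extensionality eqV /functional_extensionality eqE.
move=> /functional_extensionality eqI; subst gV gE gI.
by congr IHom; apply: proof_irrelevance.
Qed.

Lemma is_iso_cancel (G H : ihgraph) (phi : ihom G H) (psi : ihom H G) :
  cancel (homV phi) (homV psi) -> cancel (homV psi) (homV phi) ->
  cancel (homE phi) (homE psi) -> cancel (homE psi) (homE phi) ->
  cancel (homI phi) (homI psi) -> cancel (homI psi) (homI phi) ->
  is_iso phi.
Proof. by move=> *; exists psi; split; apply: ihom_ext. Qed.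

(** The coordinates [x] and [y] stay as they are. An edge of [G] is by conversion a vertex of [G^#],
    so the edge-vertex pairs tagged 2 become vertex-vertex pairs, tagged 1. *)
Definition dual_lapV (G H : ihgraph) (v : lap_edge G H) : lap_vertex G^# H :=
  match v with
  | LE2 x y => @LV1 G^# H x y
  | LE3 x y => @LV4 G^# H x y
  end.

Definition dual_lapE (G H : ihgraph) (e : lap_vertex G H) : lap_edge G^# H :=
  match e with
  | LV1 x y => @LE2 G^# H x y
  | LV4 x y => @LE3 G^# H x y
  end.

Definition dual_lapI (G H : ihgraph) (i : lap_incidence G H) : lap_incidence G^# H :=
  match i with
  | LI1 x y => @LI1 G^# H x y
  | LI2 x y => @LI2 G^# H x y
  | LI3 x y => @LI4 G^# H x y
  | LI4 x y => @LI3 G^# H x y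
  end.

Definition dual_lap (G H : ihgraph) : ihom ((G ■ H)^#) (G^# ■ H).
Proof.
(* Both squares compute on each constructor. The image of [LI3 x y] must have vertex
   [LV1 x (vert_of y)] and edge [LE3 x (edge_of y)], which are those of [LI4 x y]. *)
by exists (@dual_lapV G H) (@dual_lapE G H) (@dual_lapI G H); case.
Defined.

Definition dual_lap_invV (G H : ihgraph) (v : lap_vertex G^# H) : lap_edge G H :=
  match v with
  | LV1 x y => @LE2 G H x y
  | LV4 x y => @LE3 G H x y
  end.

Definition dual_lap_invE (G H : ihgraph) (e : lap_edge G^# H) : lap_vertex G H :=
  match e with
  | LE2 x y => @LV1 G H x y
  | LE3 x y => @LV4 G H x y
  end.

Definition dual_lap_invI (G H : ihgraph) (i : lap_incidence G^# H) : lap_incidence G H :=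
  match i with
  | LI1 x y => @LI1 G H x y
  | LI2 x y => @LI2 G H x y
  | LI3 x y => @LI4 G H x y
  | LI4 x y => @LI3 G H x y
  end.

(** Up to identifying a double dual with the graph itself, this is the dual of [dual_lap G^# H]. *)
Definition dual_lap_inv (G H : ihgraph) : ihom (G^# ■ H) ((G ■ H)^#).
Proof.
by exists (@dual_lap_invV G H) (@dual_lap_invE G H) (@dual_lap_invI G H); case.
Defined.

(** Tag 1 holds an edge of [G] and a vertex of [H]. The latter is an edge of [H^#], so over [G] and
    [H^#] this is an edge-edge pair, tagged 4. *)
Definition lap_dualV (G H : ihgraph) (v : lap_vertex G^# H) : lap_vertex G H^# :=
  match v with
  | LV1 x y => @LV4 G H^# x y
  | LV4 x y => @LV1 G H^# x y
  end.

Definition lap_dualE (G H : ihgraph) (e : lap_edge G^# H) : lap_edge G H^# :=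
  match e with
  | LE2 x y => @LE3 G H^# x y
  | LE3 x y => @LE2 G H^# x y
  end.

Definition lap_dualI (G H : ihgraph) (i : lap_incidence G^# H) : lap_incidence G H^# :=
  match i with
  | LI1 x y => @LI2 G H^# x y
  | LI2 x y => @LI1 G H^# x y
  | LI3 x y => @LI4 G H^# x y
  | LI4 x y => @LI3 G H^# x y
  end.

Definition lap_dual (G H : ihgraph) : ihom (G^# ■ H) (G ■ H^#).
Proof.
by exists (@lap_dualV G H) (@lap_dualE G H) (@lap_dualI G H); case.
Defined.

Definition lap_dual_invV (G H : ihgraph) (v : lap_vertex G H^#) : lap_vertex G^# H :=
  match v with
  | LV1 x y => @LV4 G^# H x y
  | LV4 x y => @LV1 G^# H x y
  end.

Definition lap_dual_invE (G H : ihgraph) (e : lap_edge G H^#) : lap_edge G^# H :=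
  match e with
  | LE2 x y => @LE3 G^# H x y
  | LE3 x y => @LE2 G^# H x y
  end.

Definition lap_dual_invI (G H : ihgraph) (i : lap_incidence G H^#) : lap_incidence G^# H :=
  match i with
  | LI1 x y => @LI2 G^# H x y
  | LI2 x y => @LI1 G^# H x y
  | LI3 x y => @LI4 G^# H x y
  | LI4 x y => @LI3 G^# H x y
  end.

(** [lap_dual] exchanges tags in pairs, so its inverse uses the same tag tables. *)
Definition lap_dual_inv (G H : ihgraph) : ihom (G ■ H^#) (G^# ■ H).
Proof.
by exists (@lap_dual_invV G H) (@lap_dual_invE G H) (@lap_dual_invI G H); case.
Defined.

Theorem mainTheorem2 :
  exists (alpha : forall G H : ihgraph, ihom (G ■ H)^# (G^# ■ H))
         (beta : forall G H : ihgraph, ihom (G^# ■ H) (G ■ H^#)),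
    natural_iso2
      (fun G G' H H' (phi : ihom G G') (psi : ihom H H') =>
         dual_hom (laplacian_hom phi psi))
      (fun G G' H H' (phi : ihom G G') (psi : ihom H H') =>
         laplacian_hom (dual_hom phi) psi)
      alpha
    /\
    natural_iso2
      (fun G G' H H' (phi : ihom G G') (psi : ihom H H') =>
         laplacian_hom (dual_hom phi) psi)
      (fun G G' H H' (phi : ihom G G') (psi : ihom H H') =>
         laplacian_hom phi (dual_hom psi))
      beta.
Proof.
exists dual_lap, lap_dual; split; split.
- by move=> G H; apply: (@is_iso_cancel _ _ _ (dual_lap_inv G H)); case.
(* Relabelling leaves coordinates untouched, so it commutes with applying [phi] and [psi] to them;
   each constructor is a computation. *)
- by move=> G G' H H' phi psi; apply: ihom_ext; case.
- by move=> G H; apply: (@is_iso_cancel _ _ _ (lap_dual_inv G H)); case.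
- by move=> G G' H H' phi psi; apply: ihom_ext; case.
Qed.
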